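(* Let $\gamma : I \to E_1^4$ be a timelike curve parametrized by arclength $s$, with Frenet frame $\{\mathbf{T},\mathbf{N},\mathbf{B}_1,\mathbf{B}_2\}$, equiform invariant tetrahedron $\{\mathbf{U}_1,\mathbf{U}_2,\mathbf{U}_3,\mathbf{U}_4\}$ and equiform curvatures $\bar{\mathcal{K}}_1,\bar{\mathcal{K}}_2,\bar{\mathcal{K}}_3$. Then $\gamma$ is a general helix if and only if $$\mathbf{U}_3''+\varphi_1\mathbf{U}_3=\varphi_2\mathbf{U}_1+\varphi_3\mathbf{U}_2+\varphi_4\mathbf{U}_4$$ along $\gamma$, where the prime denotes $d/d\sigma$ ($\sigma$ the equiform parameter), the dot denotes $d/ds$, and $$\varphi_1=-\rho\dot{\bar{\mathcal{K}}}_1-\bar{\mathcal{K}}_1^2+\bar{\mathcal{K}}_2^2+\bar{\mathcal{K}}_3^2,\quad \varphi_2=-\bar{\mathcal{K}}_2,\quad \varphi_3=-2\bar{\mathcal{K}}_1\bar{\mathcal{K}}_2,\quad \varphi_4=2\bar{\mathcal{K}}_1\bar{\mathcal{K}}_3.$$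
   Context: $E_1^4$ is $\mathbb{R}^4$ with the pseudo scalar product $\langle x,y\rangle=-x_1y_1+x_2y_2+x_3y_3+x_4y_4$, and $\|x\|=\sqrt{|\langle x,x\rangle|}$. All curves are smooth and defined on an interval $I\subset\mathbb{R}$. A curve $\gamma$ is timelike if its velocity satisfies $\langle\dot\gamma,\dot\gamma\rangle<0$ everywhere; it is parametrized by arclength $s$ if $\|d\gamma/ds\|=1$. Frenet frame of a timelike curve: $\gamma$ is assumed to have a moving frame of mutually orthogonal vectors $\{\mathbf{T},\mathbf{N},\mathbf{B}_1,\mathbf{B}_2\}$ with $\mathbf{T}=d\gamma/ds$, $\langle\mathbf{T},\mathbf{T}\rangle=-1$, $\langle\mathbf{N},\mathbf{N}\rangle=\langle\mathbf{B}_1,\mathbf{B}_1\rangle=\langle\mathbf{B}_2,\mathbf{B}_2\rangle=1$, and curvature functions $\bar\kappa_1>0$, $\bar\kappa_2,\bar\kappa_3$ such that $$\frac{d\mathbf{T}}{ds}=\bar\kappa_1\mathbf{N},\quad \frac{d\mathbf{N}}{ds}=\bar\kappa_1\mathbf{T}+\bar\kappa_2\mathbf{B}_1,\quad \frac{d\mathbf{B}_1}{ds}=-\bar\kappa_2\mathbf{N}+\bar\kappa_3\mathbf{B}_2,\quad \frac{d\mathbf{B}_2}{ds}=-\bar\kappa_3\mathbf{B}_1.$$ Equiform quantities: $\rho=1/\bar\kappa_1$; the equiform parameter is $\sigma=\int\bar\kappa_1\,ds$, so $d/d\sigma=\rho\,d/ds$. The equiform invariant tetrahedron is $\mathbf{U}_1=\rho\mathbf{T}$,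 $\mathbf{U}_2=\rho\mathbf{N}$, $\mathbf{U}_3=\rho\mathbf{B}_1$, $\mathbf{U}_4=\rho\mathbf{B}_2$. The equiform curvatures are $\bar{\mathcal{K}}_1=d\rho/ds$, $\bar{\mathcal{K}}_2=\bar\kappa_2/\bar\kappa_1$, $\bar{\mathcal{K}}_3=\bar\kappa_3/\bar\kappa_1$. A timelike curve is a general helix if and only if $\bar{\mathcal{K}}_2$ and $\bar{\mathcal{K}}_3$ are both constant (no condition on $\bar{\mathcal{K}}_1$); this is taken as the definition. *)

(* Defs.v *)
From HB Require Import structures.
From mathcomp Require Import all_boot all_order all_algebra.
From mathcomp Require Import all_classical all_reals all_analysis.

Set Implicit Arguments.
Unset Strict Implicit.
Unset Printing Implicit Defensive.

Import Order.TTheory GRing.Theory Num.Theory.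
Import numFieldNormedType.Exports.

Local Open Scope classical_set_scope.
Local Open Scope ring_scope.

Section Calculus.
Context {R : realType} {V : normedModType R}.
Implicit Types (I : set R) (p : R -> R) (f : R -> V).

(* The difference quotients of f at s with respect to the parameter p: as t
   tends to s inside I they tend to df/dp.  At an endpoint of I that belongs
   to I this is the one-sided derivative; values outside I play no role. *)
Definition dquot p f (s : R) : R -> V :=
  fun t => (p t - p s)^-1 *: (f t - f s).

Definition derivable_wrt I p f (s : R) : Prop :=
  cvg (dquot p f s @ within I s^').

Definition derive_wrt I p f (s : R) : V :=
  lim (dquot p f s @ within I s^').

(* d/ds is the derivative with respect to the parameter [id]. *)
Definition derivable_in I f (s : R) : Prop := derivable_wrt I id f s.

Definition derive_in I f (s : R) : V := derive_wrt I id f s.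

Definition smooth_on I f : Prop :=
  forall (n : nat) (s : R), I s -> derivable_in I (iter n (derive_in I) f) s.

End Calculus.

Section Minkowski.
Context {R : realType}.
Implicit Types (x y : 'rV[R]_4).

(* The coordinates x_1, ..., x_4 are the entries of index 0, ..., 3. *)
Definition mink x y : R :=
  - (x 0 0 * y 0 0) + x 0 1 * y 0 1 + x 0 2 * y 0 2 + x 0 3 * y 0 3.

Definition mnorm x : R := Num.sqrt `|mink x x|.

End Minkowski.

Section Curves.
Context {R : realType}.
Implicit Types (I : set R) (gamma : R -> 'rV[R]_4) (sigma : R -> R).

Definition timelike I gamma : Prop := forall s, I s ->
  mink (derive_in I gamma s) (derive_in I gamma s) < 0.

Definition arclength_param I gamma : Prop := forall s, I s ->
  mnorm (derive_in I gamma s) = 1.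

Record frenet_frame I gamma (T N B1 B2 : R -> 'rV[R]_4)
    (k1 k2 k3 : R -> R) : Prop := FrenetFrame {
  frenet_smooth : [/\ smooth_on I T, smooth_on I N, smooth_on I B1 &
    smooth_on I B2] ;
  frenet_tangent : forall s, I s -> T s = derive_in I gamma s ;
  frenet_T_unit : forall s, I s -> mink (T s) (T s) = -1 ;
  frenet_unit : forall s, I s -> [/\ mink (N s) (N s) = 1,
    mink (B1 s) (B1 s) = 1 & mink (B2 s) (B2 s) = 1] ;
  frenet_T_orth : forall s, I s -> [/\ mink (T s) (N s) = 0,
    mink (T s) (B1 s) = 0 & mink (T s) (B2 s) = 0] ;
  frenet_orth : forall s, I s -> [/\ mink (N s) (B1 s) = 0,
    mink (N s) (B2 s) = 0 & mink (B1 s) (B2 s) = 0] ;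
  frenet_k1_gt0 : forall s, I s -> 0 < k1 s ;
  frenet_dT : forall s, I s -> derive_in I T s = k1 s *: N s ;
  frenet_dN : forall s, I s ->
    derive_in I N s = k1 s *: T s + k2 s *: B1 s ;
  frenet_dB1 : forall s, I s ->
    derive_in I B1 s = - k2 s *: N s + k3 s *: B2 s ;
  frenet_dB2 : forall s, I s -> derive_in I B2 s = - k3 s *: B1 s
}.

Definition equiform_radius (k1 : R -> R) (s : R) : R := (k1 s)^-1.

(* sigma is an indefinite integral of k1 ds on I. *)
Definition equiform_parameter I (k1 : R -> R) sigma : Prop := forall s, I s ->
  derivable_in I sigma s /\ derive_in I sigma s = k1 s.

(* The member rho X of the equiform invariant tetrahedron that corresponds to
   the member X of the Frenet frame. *)
Definition equiform_vector (k1 : R -> R) (X : R -> 'rV[R]_4) (s : R) : 'rV[R]_4 :=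
  equiform_radius k1 s *: X s.

Definition equiform_curv1 I (k1 : R -> R) : R -> R := derive_in I (equiform_radius k1).
Definition equiform_curv2 (k1 k2 : R -> R) (s : R) : R := k2 s / k1 s.
Definition equiform_curv3 (k1 k3 : R -> R) (s : R) : R := k3 s / k1 s.

Definition constant_on I (f : R -> R) : Prop :=
  exists c, forall s, I s -> f s = c.

Definition general_helix I (k1 k2 k3 : R -> R) : Prop :=
  constant_on I (equiform_curv2 k1 k2) /\
  constant_on I (equiform_curv3 k1 k3).

End Curves.

(* Main.v *)
Require Import Defs.
From mathcomp Require Import all_boot all_order all_algebra.
From mathcomp Require Import all_classical all_reals all_analysis.
From mathcomp Require Import ring lra.

Import Order.TTheory GRing.Theory Num.Theory.
Import numFieldNormedType.Exports.

Local Open Scope classical_set_scope.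
Local Open Scope ring_scope.

(** Since [d/dsigma = rho d/ds], the Frenet equations give
      [U2' = U1 + K1 U2 + K2 U3],
      [U3' = - K2 U2 + K1 U3 + K3 U4],
      [U4' = - K3 U3 + K1 U4]
    (lemmas [has_deriv_U2], [derive_wrt_U3] and [has_deriv_U4]).  A second
    differentiation of [U3'] yields
      [U3'' = - K2 U1 - (2 K1 K2 + rho dK2/ds) U2
              + (rho dK1/ds + K1^2 - K2^2 - K3^2) U3
              + (2 K1 K3 + rho dK3/ds) U4]
    (lemma [derive2_wrt_U3]), so at each point the equation of the theorem says
    that [- rho dK2/ds U2 + rho dK3/ds U4 = 0].  As [U2] and [U4] are spacelike
    and orthogonal, this means that [K2] and [K3] have zero derivative
    (lemma [equiform_equationP]), and on an interval a function with zero
    derivative is constant (lemma [has_deriv0_constant_on]).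

    Two points need care.  All derivatives are taken inside [I], hence are
    one-sided at its endpoints; the few rules of calculus that are needed are
    proved for such derivatives.  Moreover no regularity of the curvatures is
    part of the definition of a Frenet frame: it follows from that of the frame
    vectors, since [k1 = <T', N>], [k2 = <N', B1>] and [k3 = <B1', B2>]. *)

Set Implicit Arguments.
Unset Strict Implicit.
Unset Printing Implicit Defensive.

(** * Calculus inside an interval *)

Section Interval.
Context {R : realType} (I : set R).

(** Points of a nondegenerate interval, endpoints included, are limits of other
    points of it, so that limits and derivatives inside it are unique. *)
Lemma within_dnbhs_proper (s : R) : is_interval I -> I° !=set0 -> I s ->
  ProperFilter (within I s^').
Proof.
move=> hI [a /nbhs_ballP[r /= r0 har]] Is.
(* Points of I close to s are found on the segment from s to t0. *)
have [t0 It0 t0s] : exists2 t, I t & t != s.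
  have [->|sa] := eqVneq s a.
    exists (a + r / 2); last by lra.
    by apply: har; rewrite /ball /= opprD addNKr normrN gtr0_norm; lra.
  by exists a; [exact/har/ballxx | rewrite eq_sym].
apply: Build_ProperFilter_ex => P /nbhs_ballP[e /= e0 he].
have d0 : 0 < `|t0 - s| by rewrite normr_gt0 subr_eq0.
pose c := Num.min 1 (e / 2 / `|t0 - s|).
have c0 : 0 < c by rewrite lt_min ltr01 divr_gt0// divr_gt0.
have c1 : c <= 1 by rewrite ge_min lexx.
have ce : c * `|t0 - s| < e.
  have : c <= e / 2 / `|t0 - s| by rewrite ge_min lexx orbT.
  by rewrite ler_pdivlMr// => /le_lt_trans; apply; lra.
exists (s + c * (t0 - s)); apply: he => /=.
- by rewrite /ball /= opprD addNKr normrN normrM gtr0_norm.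
- by rewrite -subr_eq0 addrAC subrr add0r mulf_neq0 ?subr_eq0// gt_eqF.
- have [ts|st] := leP t0 s.
    by apply: (hI _ _ It0 Is); apply/andP; split; nra.
  by apply: (hI _ _ Is It0); apply/andP; split; nra.
Qed.

End Interval.

Section Derivative.
Context {R : realType} {V : normedModType R} (I : set R).
Implicit Types (a : R -> R) (f g : R -> V) (s : R).

(** [f] has derivative [l] at [s] inside [I]: the relational counterpart of
    [derive_in], which is meaningful only where the limit exists. *)
Definition has_deriv_in f s (l : V) : Prop :=
  dquot id f s @ within I s^' --> l.

Lemma derivable_in_has_deriv f s :
  derivable_in I f s -> has_deriv_in f s (derive_in I f s).
Proof. by []. Qed.

Lemma has_deriv_derivable f s l : has_deriv_in f s l -> derivable_in I f s.
Proof. by move=> fl; apply: cvgP fl. Qed.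

Lemma has_deriv_val f s l : is_interval I -> I° !=set0 -> I s ->
  has_deriv_in f s l -> derive_in I f s = l.
Proof.
move=> hI hI0 Is fl; have := within_dnbhs_proper hI hI0 Is => ?.
exact: (cvg_lim (@norm_hausdorff _ _)) fl.
Qed.

Lemma near_dnbhs_in s (P : set R) : (forall t, I t -> t != s -> P t) ->
  \forall t \near within I s^', P t.
Proof.
move=> h; rewrite near_withinE; near=> t => It; apply: h => //.
by near: t; exact: nbhs_dnbhs_neq.
Unshelve. all: end_near. Qed.

Lemma cvg_in_eq (q1 q2 : R -> V) s (l : V) : q1 @ within I s^' --> l ->
  (forall t, I t -> t != s -> q1 t = q2 t) -> q2 @ within I s^' --> l.
Proof.
move=> ql eq12; have e12 : {near within I s^', q1 =1 q2} by exact: near_dnbhs_in.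
by apply: cvg_trans ql; exact: near_eq_cvg.
Qed.

Lemma has_deriv_ext f g s l : (forall t, I t -> f t = g t) -> I s ->
  has_deriv_in f s l -> has_deriv_in g s l.
Proof.
move=> fg Is fl; apply: (cvg_in_eq fl) => t It _.
by rewrite /dquot !fg.
Qed.

Lemma has_deriv_cvg f s l : has_deriv_in f s l -> f @ within I s^' --> f s.
Proof.
move=> fl.
have ts0 : (fun t => t - s) @ within I s^' --> (0 : R).
  have : (fun t => t - s) @ nbhs s --> (0 : R).
    by rewrite -(subrr s); apply: cvgB; [exact: cvg_id | exact: cvg_cst].
  by move=> h; do 2 apply: cvg_within_filter.
have h : (fun t => f s + (t - s) *: dquot id f s t) @ within I s^'
    --> f s + (0 : R) *: l.
  by apply: cvgD; [exact: cvg_cst | exact: cvgZ].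
rewrite scale0r addr0 in h; apply: (cvg_in_eq h) => t It ts.
by rewrite /dquot scalerA divff ?subr_eq0// scale1r addrC subrK.
Qed.

Lemma has_derivD f g s l m : has_deriv_in f s l -> has_deriv_in g s m ->
  has_deriv_in (fun t => f t + g t) s (l + m).
Proof.
move=> fl gm; apply: (cvg_in_eq (cvgD fl gm)) => t _ _.
by rewrite /dquot fctE -scalerDr opprD addrACA.
Qed.

Lemma has_derivN f s l : has_deriv_in f s l ->
  has_deriv_in (fun t => - f t) s (- l).
Proof.
move=> fl; apply: (cvg_in_eq (cvgN fl)) => t _ _.
by rewrite /dquot fctE -scalerN opprB opprK (addrC (- f t)).
Qed.

End Derivative.

Section ScalarDerivative.
Context {R : realType} {V : normedModType R} (I : set R).
Implicit Types (a b : R -> R) (f g : R -> V) (s : R).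

Lemma has_derivZ a f s m l : has_deriv_in I a s m -> has_deriv_in I f s l ->
  has_deriv_in I (fun t => a t *: f t) s (m *: f s + a s *: l).
Proof.
move=> am fl; have fs := has_deriv_cvg fl.
have h1 : (fun t => dquot id a s t *: f t) @ within I s^' --> m *: f s by exact: cvgZ.
have h2 : (fun t => a s *: dquot id f s t) @ within I s^' --> a s *: l.
  by apply: cvgZ => //; exact: cvg_cst.
apply: (cvg_in_eq (cvgD h1 h2)) => t _ _; rewrite /dquot fctE.
rewrite -scalerA (scalerA (a s)) (mulrC (a s)) -(scalerA _ (a s)) -scalerDr.
by rewrite scalerBl scalerBr addrA subrK.
Qed.

Lemma has_derivM a b s m l : has_deriv_in I a s m -> has_deriv_in I b s l ->
  has_deriv_in I (fun t => a t * b t) s (m * b s + a s * l).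
Proof.
move=> am bl; have bs := has_deriv_cvg bl.
have h1 : (fun t => dquot id a s t * b t) @ within I s^' --> m * b s by exact: cvgM.
have h2 : (fun t => a s * dquot id b s t) @ within I s^' --> a s * l.
  by apply: cvgM => //; exact: cvg_cst.
apply: (cvg_in_eq (cvgD h1 h2)) => t _ _; rewrite /dquot fctE /=.
by rewrite /GRing.scale /=; ring.
Qed.

Lemma has_derivV a s m : (forall t, I t -> a t != 0) -> I s ->
  has_deriv_in I a s m -> has_deriv_in I (fun t => (a t)^-1) s (- (a s ^- 2 * m)).
Proof.
move=> a0 Is am; have as_ := has_deriv_cvg am.
have h1 : (fun t => (a t)^-1) @ within I s^' --> (a s)^-1.
  by apply: cvgV => //; exact: a0.
have h2 : (fun t => - ((a s)^-1 * (a t)^-1 * dquot id a s t)) @ within I s^'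
    --> - (a s ^- 2 * m).
  rewrite expr2 invfM.
  exact: (cvgN (cvgM (cvgM (cvg_cst (a s)^-1) h1) am)).
apply: (cvg_in_eq h2) => t It ts; rewrite /dquot /= /GRing.scale /=.
by field; rewrite subr_eq0 ts !a0.
Qed.

(** The chain rule [df/dp = (dp/ds)^-1 df/ds]. *)
Lemma derive_wrtE p f s q l : is_interval I -> I° !=set0 -> I s -> q != 0 ->
  has_deriv_in I p s q -> has_deriv_in I f s l ->
  derive_wrt I p f s = q^-1 *: l.
Proof.
move=> hI hI0 Is q0 pq fl; have := within_dnbhs_proper hI hI0 Is => ?.
apply: (cvg_lim (@norm_hausdorff _ _)).
(* Where p t = p s both sides below are 0, because 0^-1 = 0. *)
apply: (cvg_in_eq (cvgZ (cvgV q0 pq) fl)) => t It ts; rewrite /dquot /= scalerA.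
have -> : (t - s)^-1 *: (p t - p s) = (t - s)^-1 * (p t - p s) by [].
by rewrite invfM invrK mulrAC divff ?mul1r// subr_eq0.
Qed.

Lemma has_deriv_coord n (f : R -> 'rV[R]_n.+1) s l i : has_deriv_in I f s l ->
  has_deriv_in I (fun t => f t 0 i) s (l 0 i).
Proof.
move=> fl.
apply: (cvg_in_eq (continuous_cvg _ (@coord_continuous R 1 n.+1 0 i l) fl)).
move=> t It ts /=.
by rewrite /dquot !mxE.
Qed.

Lemma constant_on_has_deriv0 a s : constant_on I a -> I s ->
  has_deriv_in I a s 0.
Proof.
move=> [c ac] Is; apply: (@cvg_in_eq _ _ _ (fun=> 0)); first exact: cvg_cst.
by move=> t It _; rewrite /dquot !ac// subrr scaler0.
Qed.

Lemma has_deriv0_constant_on a : is_interval I ->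
  (forall s, I s -> has_deriv_in I a s 0) -> constant_on I a.
Proof.
move=> hI ha.
have lt_eq x y : I x -> I y -> x < y -> a x = a y.
  move=> Ix Iy xy.
  have sub z : z \in `[x, y] -> I z by rewrite in_itv /= => /(hI _ _ Ix Iy).
  (* Inside the open interval the derivative inside I is the ordinary one, and
     a is continuous up to the endpoints: the mean value theorem applies. *)
  suff [c _] : exists2 c, c \in `]x, y[ & a y - a x = 0 * (y - x).
    by rewrite mul0r => /eqP; rewrite subr_eq0 => /eqP.
  apply: (@MVT R a (fun=> 0) x y) => //.
    move=> z zxy; have Iz := sub _ (subset_itv_oo_cc zxy).
    have hz : (fun h => h^-1 *: ((a \o shift z) (h *: 1) - a z)) @ 0^' --> (0 : R).
      move=> A /(ha z Iz) hA.
      have {}hA : \forall t \near z, t != z -> A (dquot id a z t).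
        near=> t => tz; have It : I t.
          by apply/sub/subset_itv_oo_cc; near: t; exact: near_in_itvoo.
        by move: tz It; near: t.
      rewrite (near_shift 0) subr0 in hA.
      apply: filterS hA => h /= hA h0.
      have := hA; rewrite /dquot /shift /= addrK scaler1; apply.
      by rewrite -subr_eq0 addrK.
    by apply: DeriveDef; [exact: cvgP hz | exact: cvg_lim hz].
  apply/subspace_continuousP => z /= /sub Iz A /= aA.
  have {ha} hA : \forall t \near z, t != z -> I t -> A (a t).
    exact: (has_deriv_cvg (ha z Iz)) aA.
  suff : \forall t \near z, t \in `[x, y] -> A (a t) by [].
  apply: filterS hA => t /= hA txy.
  have [->|tz] := eqVneq t z; first exact: nbhs_singleton aA.
  by apply: hA => //; exact: sub.
have [[s Is]|nI] := pselect (exists s, I s); last first.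
  by exists 0 => s Is; case: nI; exists s.
exists (a s) => t It.
by case: (ltgtP t s) => [ts|st|->//]; [exact: lt_eq|apply/esym; exact: lt_eq].
Unshelve. all: end_near. Qed.

End ScalarDerivative.

(** * The pseudo scalar product *)

Section Mink.
Context {R : realType} (I : set R).
Implicit Types (x y z : 'rV[R]_4).

Lemma minkC x y : mink x y = mink y x.
Proof. by rewrite /mink; ring. Qed.

Lemma minkDl x y z : mink (x + y) z = mink x z + mink y z.
Proof. by rewrite /mink !mxE; ring. Qed.

Lemma minkZl c x z : mink (c *: x) z = c * mink x z.
Proof. by rewrite /mink !mxE; ring. Qed.

Lemma mink0l z : mink 0 z = 0.
Proof. by rewrite /mink !mxE; ring. Qed.

Lemma has_deriv_mink (X Y : R -> 'rV[R]_4) s dX dY :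
  has_deriv_in I X s dX -> has_deriv_in I Y s dY ->
  has_deriv_in I (fun t => mink (X t) (Y t)) s (mink dX (Y s) + mink (X s) dY).
Proof.
move=> hX hY.
have h i := has_derivM (has_deriv_coord (i := i) hX) (has_deriv_coord (i := i) hY).
have := has_derivD (has_derivD (has_derivD (has_derivN (h 0)) (h 1)) (h 2)) (h 3).
by congr has_deriv_in; rewrite /mink; ring.
Qed.

End Mink.

(** * Derivatives of the equiform frame and curvatures *)

Section Frame.
Context {R : realType} {I : set R} {gamma T N B1 B2 : R -> 'rV[R]_4}.
Context {k1 k2 k3 sigma : R -> R}.
Context (hI : is_interval I) (hI0 : I° !=set0).
Context (hframe : frenet_frame I gamma T N B1 B2 k1 k2 k3).
Context (hsigma : equiform_parameter I k1 sigma).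

Let rho := equiform_radius k1.
Let U1 := equiform_vector k1 T.
Let U2 := equiform_vector k1 N.
Let U3 := equiform_vector k1 B1.
Let U4 := equiform_vector k1 B2.
Let K1 := equiform_curv1 I k1.
Let K2 := equiform_curv2 k1 k2.
Let K3 := equiform_curv3 k1 k3.

Let k1_neq0 s : I s -> k1 s != 0.
Proof. by move=> /(frenet_k1_gt0 hframe)/lt0r_neq0. Qed.

(** The next three lemmas express the curvatures through the frame, and so
    provide their differentiability. *)
Lemma frenet_k1E s : I s -> k1 s = mink (derive_in I T s) (N s).
Proof.
move=> Is; have [N1 _ _] := frenet_unit hframe Is.
by rewrite (frenet_dT hframe Is) minkZl N1 mulr1.
Qed.

Lemma frenet_k2E s : I s -> k2 s = mink (derive_in I N s) (B1 s).
Proof.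
move=> Is; have [_ B11 _] := frenet_unit hframe Is.
have [_ TB1 _] := frenet_T_orth hframe Is.
by rewrite (frenet_dN hframe Is) minkDl !minkZl TB1 B11; ring.
Qed.

Lemma frenet_k3E s : I s -> k3 s = mink (derive_in I B1 s) (B2 s).
Proof.
move=> Is; have [_ _ B22] := frenet_unit hframe Is.
have [_ NB2 _] := frenet_orth hframe Is.
by rewrite (frenet_dB1 hframe Is) minkDl !minkZl NB2 B22; ring.
Qed.

Let dX1 (X : R -> 'rV[R]_4) s : smooth_on I X -> I s ->
  has_deriv_in I X s (derive_in I X s).
Proof. by move=> hX Is; exact: (derivable_in_has_deriv (hX 0%N s Is)). Qed.

Let dX2 (X : R -> 'rV[R]_4) s : smooth_on I X -> I s ->
  has_deriv_in I (derive_in I X) s (derive_in I (derive_in I X) s).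
Proof. by move=> hX Is; exact: (derivable_in_has_deriv (hX 1%N s Is)). Qed.

(** The derivative of [k1 = <T', N>], itself differentiable; this is what makes
    [K1], a first derivative of [1 / k1], differentiable. *)
Let dk1 s := mink (derive_in I (derive_in I T) s) (N s)
  + mink (derive_in I T s) (derive_in I N s).

Lemma has_deriv_k1 s : I s -> has_deriv_in I k1 s (dk1 s).
Proof.
move=> Is; have [hT hN _ _] := frenet_smooth hframe.
apply: has_deriv_ext (has_deriv_mink (dX2 hT Is) (dX1 hN Is)) => // t It.
exact/esym/frenet_k1E.
Qed.

Lemma derivable_k2 s : I s -> derivable_in I k2 s.
Proof.
move=> Is; have [_ hN hB1 _] := frenet_smooth hframe.
apply: has_deriv_derivable.
apply: has_deriv_ext (has_deriv_mink (dX2 hN Is) (dX1 hB1 Is)) => // t It.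
exact/esym/frenet_k2E.
Qed.

Lemma derivable_k3 s : I s -> derivable_in I k3 s.
Proof.
move=> Is; have [_ _ hB1 hB2] := frenet_smooth hframe.
apply: has_deriv_derivable.
apply: has_deriv_ext (has_deriv_mink (dX2 hB1 Is) (dX1 hB2 Is)) => // t It.
exact/esym/frenet_k3E.
Qed.

Lemma derivable_dk1 s : I s -> derivable_in I dk1 s.
Proof.
move=> Is; have [hT hN _ _] := frenet_smooth hframe.
apply: has_deriv_derivable; apply: has_derivD.
  exact: has_deriv_mink (derivable_in_has_deriv (hT 2%N s Is)) (dX1 hN Is).
exact: has_deriv_mink (dX2 hT Is) (dX2 hN Is).
Qed.

Let has_deriv_rho_aux s : I s -> has_deriv_in I rho s (- (k1 s ^- 2 * dk1 s)).
Proof. by move=> Is; apply: has_derivV => //; exact: has_deriv_k1. Qed.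

Lemma has_deriv_rho s : I s -> has_deriv_in I rho s (K1 s).
Proof. by move=> /has_deriv_rho_aux/has_deriv_derivable. Qed.

Lemma has_deriv_K1 s : I s -> has_deriv_in I K1 s (derive_in I K1 s).
Proof.
move=> Is; apply/derivable_in_has_deriv.
have hrho := has_deriv_rho_aux Is.
have h := has_derivN (has_derivM (has_derivM hrho hrho)
  (derivable_in_has_deriv (derivable_dk1 Is))).
apply: has_deriv_derivable; apply: has_deriv_ext h => // t It.
rewrite /K1 /equiform_curv1 (has_deriv_val hI hI0 It (has_deriv_rho_aux It)).
by rewrite /rho /equiform_radius -invfM.
Qed.

Lemma has_deriv_K2 s : I s -> has_deriv_in I K2 s (derive_in I K2 s).
Proof.
move=> Is; apply/derivable_in_has_deriv; apply: has_deriv_derivable.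
exact: has_derivM (derivable_in_has_deriv (derivable_k2 Is)) (has_deriv_rho Is).
Qed.

Lemma has_deriv_K3 s : I s -> has_deriv_in I K3 s (derive_in I K3 s).
Proof.
move=> Is; apply/derivable_in_has_deriv; apply: has_deriv_derivable.
exact: has_derivM (derivable_in_has_deriv (derivable_k3 Is)) (has_deriv_rho Is).
Qed.

(** [d/dsigma = rho d/ds]. *)
Lemma derive_wrt_sigma (f : R -> 'rV[R]_4) s l : I s -> has_deriv_in I f s l ->
  derive_wrt I sigma f s = rho s *: l.
Proof.
move=> Is hf; have [hs dsigma] := hsigma Is.
have {hs} hs : has_deriv_in I sigma s (k1 s) by rewrite -dsigma.
exact: (derive_wrtE hI hI0 Is (k1_neq0 Is) hs hf).
Qed.

Let has_deriv_U X dX s : smooth_on I X -> derive_in I X s = dX -> I s ->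
  has_deriv_in I (equiform_vector k1 X) s (K1 s *: X s + rho s *: dX).
Proof.
by move=> hX <- Is; apply: has_derivZ; [exact: has_deriv_rho | exact: dX1].
Qed.

Lemma has_deriv_U2 s : I s ->
  has_deriv_in I U2 s (k1 s *: (U1 s + K1 s *: U2 s + K2 s *: U3 s)).
Proof.
move=> Is; have [_ hN _ _] := frenet_smooth hframe.
have := has_deriv_U hN (frenet_dN hframe Is) Is; congr has_deriv_in.
apply/rowP => i; rewrite !mxE /K2 /equiform_curv2 /rho /equiform_radius.
by field; exact: k1_neq0.
Qed.

Lemma has_deriv_U3 s : I s ->
  has_deriv_in I U3 s (k1 s *: (K1 s *: U3 s - K2 s *: U2 s + K3 s *: U4 s)).
Proof.
move=> Is; have [_ _ hB1 _] := frenet_smooth hframe.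
have := has_deriv_U hB1 (frenet_dB1 hframe Is) Is; congr has_deriv_in.
apply/rowP => i.
rewrite !mxE /K2 /equiform_curv2 /K3 /equiform_curv3 /rho /equiform_radius.
by field; exact: k1_neq0.
Qed.

Lemma has_deriv_U4 s : I s ->
  has_deriv_in I U4 s (k1 s *: (K1 s *: U4 s - K3 s *: U3 s)).
Proof.
move=> Is; have [_ _ _ hB2] := frenet_smooth hframe.
have := has_deriv_U hB2 (frenet_dB2 hframe Is) Is; congr has_deriv_in.
apply/rowP => i; rewrite !mxE /K3 /equiform_curv3 /rho /equiform_radius.
by field; exact: k1_neq0.
Qed.

Lemma derive_wrt_U3 s : I s ->
  derive_wrt I sigma U3 s = K1 s *: U3 s - K2 s *: U2 s + K3 s *: U4 s.
Proof.
move=> Is; rewrite (derive_wrt_sigma Is (has_deriv_U3 Is)) scalerA.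
by rewrite mulVf ?scale1r//; exact: k1_neq0.
Qed.

Lemma derive2_wrt_U3 s : I s ->
  derive_wrt I sigma (derive_wrt I sigma U3) s =
    - K2 s *: U1 s
    - (2 * K1 s * K2 s + rho s * derive_in I K2 s) *: U2 s
    + (rho s * derive_in I K1 s + K1 s ^+ 2 - K2 s ^+ 2 - K3 s ^+ 2) *: U3 s
    + (2 * K1 s * K3 s + rho s * derive_in I K3 s) *: U4 s.
Proof.
move=> Is.
have h := has_derivD (has_derivD
  (has_derivZ (has_deriv_K1 Is) (has_deriv_U3 Is))
  (has_derivN (has_derivZ (has_deriv_K2 Is) (has_deriv_U2 Is))))
  (has_derivZ (has_deriv_K3 Is) (has_deriv_U4 Is)).
have {}h := has_deriv_ext (fun t It => esym (derive_wrt_U3 It)) Is h.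
rewrite (derive_wrt_sigma Is h); apply/rowP => i; rewrite !mxE.
move: (derive_in I K1 s) (derive_in I K2 s) (derive_in I K3 s) => d1 d2 d3.
rewrite /rho /equiform_radius; move: (K1 s) (K2 s) (K3 s) => c1 c2 c3.
by field; exact: k1_neq0.
Qed.

(** Pointwise, the differential equation of the theorem says that [K2] and [K3]
    are stationary. *)
Lemma equiform_equationP s : I s ->
  derive_wrt I sigma (derive_wrt I sigma U3) s
    + (- (rho s * derive_in I K1 s) - K1 s ^+ 2 + K2 s ^+ 2 + K3 s ^+ 2) *: U3 s
  = - K2 s *: U1 s + - (2 * K1 s * K2 s) *: U2 s + (2 * K1 s * K3 s) *: U4 s <->
  derive_in I K2 s = 0 /\ derive_in I K3 s = 0.
Proof.
move=> Is; rewrite derive2_wrt_U3//.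
move: (derive_in I K1 s) (derive_in I K2 s) (derive_in I K3 s) => d1 d2 d3.
move: (K1 s) (K2 s) (K3 s) => c1 c2 c3; split=> [E|[-> ->]]; last first.
  by apply/rowP => i; rewrite !mxE; ring.
(* Comparing the coefficients of U2 and U4 amounts to pairing with N and B2. *)
have rho0 : rho s != 0 by rewrite invr_neq0// k1_neq0.
have {E} : (- (rho s * rho s * d2)) *: N s + (rho s * rho s * d3) *: B2 s = 0.
  move/eqP: E; rewrite -subr_eq0 => /eqP <-.
  by apply/rowP => i; rewrite !mxE -/rho; ring.
have [N1 _ B22] := frenet_unit hframe Is; have [_ NB2 _] := frenet_orth hframe Is.
move=> E; split; apply/eqP.
  have /eqP := congr1 (mink^~ (N s)) E.
  rewrite minkDl !minkZl mink0l N1 (minkC (B2 s)) NB2 mulr1 mulr0 addr0 oppr_eq0.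
  by rewrite !mulf_eq0 (negPf rho0).
have /eqP := congr1 (mink^~ (B2 s)) E.
rewrite minkDl !minkZl mink0l B22 NB2 mulr1 mulr0 add0r.
by rewrite !mulf_eq0 (negPf rho0).
Qed.

Lemma general_helixP : general_helix I k1 k2 k3 <->
  forall s, I s -> derive_in I K2 s = 0 /\ derive_in I K3 s = 0.
Proof.
split=> [[c2 c3] s Is|h].
  by split; apply: (has_deriv_val hI hI0 Is); exact: constant_on_has_deriv0.
split; apply: has_deriv0_constant_on => // s Is; have [h2 h3] := h s Is.
  by rewrite -h2; exact: has_deriv_K2.
by rewrite -h3; exact: has_deriv_K3.
Qed.

End Frame.

Unset Implicit Arguments.

Theorem theorem4p6 (R : realType) (I : set R)
    (hI : is_interval I) (hI0 : I° !=set0)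
    (gamma T N B1 B2 : R -> 'rV[R]_4) (k1 k2 k3 sigma : R -> R)
    (hgamma : smooth_on I gamma)
    (htimelike : timelike I gamma)
    (harclength : arclength_param I gamma)
    (hframe : frenet_frame I gamma T N B1 B2 k1 k2 k3)
    (hsigma : equiform_parameter I k1 sigma) :
  let rho := equiform_radius k1 in
  let U1 := equiform_vector k1 T in
  let U2 := equiform_vector k1 N in
  let U3 := equiform_vector k1 B1 in
  let U4 := equiform_vector k1 B2 in
  let K1 := equiform_curv1 I k1 in
  let K2 := equiform_curv2 k1 k2 in
  let K3 := equiform_curv3 k1 k3 in
  let phi1 s := - (rho s * derive_in I K1 s) - K1 s ^+ 2
                + K2 s ^+ 2 + K3 s ^+ 2 in
  let phi2 s := - K2 s in
  let phi3 s := - (2 * K1 s * K2 s) in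
  let phi4 s := 2 * K1 s * K3 s in
  general_helix I k1 k2 k3 <->
  (forall s, I s ->
     derive_wrt I sigma (derive_wrt I sigma U3) s + phi1 s *: U3 s
     = phi2 s *: U1 s + phi3 s *: U2 s + phi4 s *: U4 s).
Proof.
move=> rho U1 U2 U3 U4 K1 K2 K3 phi1 phi2 phi3 phi4.
rewrite (general_helixP hI hI0 hframe).
by split=> h s Is; apply/(equiform_equationP hI hI0 hframe hsigma Is); exact: h.
Qed.
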